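(* For $\lambda>0$, let $Z_\lambda$ be a Poisson random variable of parameter $\lambda$, and set $\hat Z_\lambda=\dfrac{Z_\lambda-\lambda}{\sqrt{\lambda}}$. Let $\mathbf P$ denote the standard Gaussian measure $\mathcal N(0,1)$ on $\mathbf R$. Let $F:\mathbf R\to\mathbf R$ be three times differentiable with bounded derivatives. Then, as $\lambda\to\infty$, $$\mathbf E\left[F(\hat Z_\lambda)\right]-\int_{\mathbf R}F\,d\mathbf P=\frac{1}{6\sqrt{\lambda}}\int_{\mathbf R}F(x)\,\mathcal H_3(x)\,d\mathbf P(x)+O(\lambda^{-1}),$$ where $\mathcal H_3$ is the third Hermite polynomial and the constant implied by $O(\lambda^{-1})$ may depend on $F$ but not on $\lambda$.
   Context: Hermite polynomials are those orthogonal with respect to the standard Gaussian measure (monic, ''probabilists''' normalization), so $\mathcal H_3(x)=x^3-3x$. *)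

(* Defs.v *)
From HB Require Import structures.
From mathcomp Require Import all_boot all_order all_algebra.
From mathcomp Require Import all_classical all_reals all_analysis.

Set Implicit Arguments.
Unset Strict Implicit.
Unset Printing Implicit Defensive.

Import Order.TTheory GRing.Theory Num.Theory.
Import numFieldNormedType.Exports.

Local Open Scope classical_set_scope.
Local Open Scope ring_scope.

Section Definitions.
Context {R : realType}.

(* [H n] is monic of degree [n], and the [H n] are pairwise orthogonal for the
   standard Gaussian measure; this determines [H]. The integral is
   extended-real-valued, so that orthogonality cannot hold through the default
   value of [Rintegral]. *)
Definition hermite_family (H : nat -> {poly R}) : Prop :=
  (forall n, H n \is monic /\ size (H n) = n.+1) /\
  (forall m n, m != n ->
    (\int[normal_prob (0 : R) 1]_x ((H m).[x] * (H n).[x])%:E = 0)%E).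

(* The [nat] argument of [poisson_prob] does not occur in its body, hence the
   arbitrary [0%N]. *)
Definition poisson_rv d (T : measurableType d) (P : probability T R)
    (rate : R) (Z : {RV P >-> nat}) : Prop :=
  distribution P Z = poisson_prob rate 0%N :> (set nat -> \bar R).

Definition standardize (rate : R) (z : nat) : R :=
  (z%:R - rate) / Num.sqrt rate.

(* [F] itself is not assumed bounded, and the third derivative is not assumed
   continuous. *)
Definition thrice_derivable_bounded (F : R -> R) : Prop :=
  (forall k x, (k < 3)%N -> derivable (F^`(k))%classic x 1) /\
  (forall k, (0 < k <= 3)%N -> bounded_fun (F^`(k))%classic).

End Definitions.

(* Main.v *)
(** Stein's method. If [f] solves [f' = x f + F - c] with [c] the Gaussian mean
    of [F], then [E F(X) - c = E (f'(X) - X f(X))] for [X] the standardized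
    Poisson variable. The Poisson identity [E Z h(Z) = l E h(Z + 1)] turns
    [E X f(X)] into [sqrt l * E (f(X + 1/sqrt l) - f(X))], and a second-order
    Taylor expansion leaves [- E f''(X) / (2 sqrt l)] up to [O(1/l)]. Running the
    first-order version of the same argument on [f''] replaces [E f''(X)] by its
    Gaussian mean, which is [-1/3] of the mean of [F H_3] by Gaussian integration
    by parts. That [f] and its first three derivatives are bounded follows from a
    maximum principle: each of them solves an equation [u' = x u + g] with [g] of
    at most linear growth. *)

Require Import Defs.
From HB Require Import structures.
From mathcomp Require Import all_boot all_order all_algebra.
From mathcomp Require Import all_classical all_reals all_analysis.
From mathcomp Require Import measurable_realfun.
From mathcomp Require Import ring lra.

Set Implicit Arguments.
Unset Strict Implicit.
Unset Printing Implicit Defensive.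

Import Order.TTheory GRing.Theory Num.Theory.
Import numFieldNormedType.Exports.

Local Open Scope classical_set_scope.
Local Open Scope ring_scope.

(** * The Gaussian measure as a density *)

Local Notation phi := (normal_pdf 0 1).
Local Notation gauss := (normal_prob 0 1).
Local Notation mu := lebesgue_measure.

(** Both densities integrate to the Gaussian mass of every measurable set, which forces equality
    almost everywhere. *)
Lemma ae_eq_Radon_Nikodym_gauss (R : realType) :
  ae_eq (mu : {measure set _ -> \bar R}) setT
    (Radon_Nikodym_SigmaFinite.f (gauss : {finite_measure set _ -> \bar R}) mu)
    (fun x : R => (phi x)%:E).
Proof.
have dom : (gauss : {finite_measure set _ -> \bar R}) `<<
    (mu : {measure set _ -> \bar R}).
  by apply: normal_prob_dominates; exact: oner_neq0.
apply: integral_ae_eq => //.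
- exact: Radon_Nikodym_SigmaFinite.f_integrable.
- by apply/measurable_EFinP; exact: measurable_normal_pdf.
- by move=> A _ mA; rewrite -Radon_Nikodym_SigmaFinite.f_integral.
Qed.

Lemma ge0_integral_gauss (R : realType) (f : R -> \bar R) :
  measurable_fun setT f -> (forall x, 0 <= f x)%E ->
  (\int[gauss]_x f x = \int[mu]_x (f x * (phi x)%:E))%E.
Proof.
move=> mf f0.
have dom : (gauss : {finite_measure set _ -> \bar R}) `<<
    (mu : {measure set _ -> \bar R}).
  by apply: normal_prob_dominates; exact: oner_neq0.
rewrite -(Radon_Nikodym_SigmaFinite.change_of_variables dom f0 measurableT mf).
apply: ae_eq_integral => //.
- apply: emeasurable_funM => //.
  exact: (measurable_int _ (Radon_Nikodym_SigmaFinite.f_integrable dom)).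
- apply: emeasurable_funM => //.
  by apply/measurable_EFinP; exact: measurable_normal_pdf.
- by apply: ae_eqe_mul2l; exact: ae_eq_Radon_Nikodym_gauss.
Qed.

(** Positive and negative parts are treated separately; as [phi] is nonnegative, multiplying by it
    commutes with taking either part. *)
Lemma integral_gauss (R : realType) (f : R -> R) :
  measurable_fun setT f ->
  mu.-integrable setT (fun x => (f x * phi x)%:E) ->
  (\int[gauss]_x (f x)%:E = \int[mu]_x (f x * phi x)%:E)%E.
Proof.
move=> mf intf; rewrite [LHS]integralE [RHS]integralE.
have mfE : measurable_fun setT (EFin \o f) by exact/measurable_EFinP.
rewrite 2?ge0_integral_gauss//; last 2 first.
- exact: measurable_funeneg.
- exact: measurable_funepos.
congr (_ - _)%E; apply: eq_integral => x _.
- rewrite !funeposE -!EFin_max -EFinM; congr EFin.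
  by rewrite maxr_pMl ?normal_pdf_ge0// mul0r.
- rewrite !funenegE -!EFinN -!EFin_max -EFinM; congr EFin.
  by rewrite maxr_pMl ?normal_pdf_ge0// mul0r mulNr.
Qed.

(** * Functions of polynomial growth *)

Section pointwise_derivatives.
Context {R : realType}.
Implicit Types (f g : R -> R) (x df dg : R).

Lemma is_derive_cst_fun (c x : R) : is_derive x 1 (fun=> c) (0 : R).
Proof. exact: is_derive_cst. Qed.

Lemma is_derive_id_fun x : is_derive x 1 (fun y : R => y) (1 : R).
Proof. exact: is_derive_id. Qed.

Lemma is_deriveD_fun f g x df dg : is_derive x 1 f df -> is_derive x 1 g dg ->
  is_derive x 1 (fun y => f y + g y) (df + dg).
Proof. exact: is_deriveD. Qed.

Lemma is_deriveM_fun f g x df dg : is_derive x 1 f df -> is_derive x 1 g dg ->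
  is_derive x 1 (fun y => f y * g y) (df * g x + f x * dg).
Proof.
move=> fx gx; apply: is_derive_eq (is_deriveM fx gx) _.
by rewrite /GRing.scale/= addrC mulrC.
Qed.

Lemma is_derive_comp_fun f g x df dg :
  is_derive (g x) 1 f df -> is_derive x 1 g dg ->
  is_derive x 1 (fun y => f (g y)) (df * dg).
Proof.
by move=> fx gx; apply: is_derive_eq (is_derive1_comp fx gx) _.
Qed.

Lemma is_derive_continuous f x df : is_derive x 1 f df -> {for x, continuous f}.
Proof.
by move=> [fx _]; apply: differentiable_continuous; exact/derivable1_diffP.
Qed.

Lemma is_derive_derive1 f x df : is_derive x 1 f df -> (f^`())%classic x = df.
Proof. by move=> fx; rewrite derive1E derive_val. Qed.

End pointwise_derivatives.

Lemma exprn_le_expR (R : realType) (n : nat) (y : R) : 0 <= y ->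
  y ^+ n <= n`!%:R * expR y.
Proof.
move=> y0; case: n => [|n]; first by have := expR_ge1Dx y; rewrite expr0 fact0 mul1r; lra.
rewrite -ler_pdivrMl ?ltr0n ?fact_gt0// mulrC.
by apply: le_trans (expR_ge1Dxn n y0); rewrite lerDr.
Qed.

(** * The Gaussian density and its decay *)

Section gaussian_density.
Context {R : realType}.

Lemma phiE (x : R) : phi x = normal_peak 1 * expR (- (x ^+ 2 / 2)).
Proof.
rewrite normal_pdfE ?oner_eq0// /normal_fun subr0 expr1n.
by rewrite mulNr mulr2n.
Qed.

Lemma phi_gt0 (x : R) : 0 < phi x.
Proof. by rewrite phiE mulr_gt0 ?expR_gt0 ?normal_peak_gt0 ?oner_eq0. Qed.

Lemma phiN (x : R) : phi (- x) = phi x :> R.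
Proof. by rewrite !phiE sqrrN. Qed.

Lemma is_derive_phi (x : R) : is_derive x 1 (phi : R -> R) (- x * phi x).
Proof.
have -> : phi = (fun x : R => normal_peak 1 * expR (- (x * x * 2^-1))).
  by apply/funext => y; rewrite phiE expr2.
by apply: is_derive_eq; rewrite /GRing.scale/=; field.
Qed.

(** The ratio of [phi] to the density of standard deviation 2 is a multiple of [exp (- 3 x^2 / 8)],
    which absorbs any power of [1 + x ^+ 2]. The wider Gaussian then serves as a bounded, integrable
    majorant. *)
Lemma phi_growth_le (n : nat) : exists C : R, forall x : R,
  (1 + x ^+ 2) ^+ n * phi x <= C * normal_pdf 0 2 x.
Proof.
(* From [y ^+ n <= n! * exp y] at [y = 3 / 8 * (1 + x ^+ 2)]; the factor [expR (3 / 8)] comes from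
   the summand 1. *)
exists ((8 / 3) ^+ n * n`!%:R * expR (3 / 8) * normal_peak 1 / normal_peak 2) => x.
have p2 : normal_peak 2 != 0 :> R by rewrite gt_eqF// normal_peak_gt0.
rewrite phiE [normal_pdf 0 2]normal_pdfE// /normal_fun subr0.
have y0 : 0 <= 3 / 8 * (1 + x ^+ 2) by have := sqr_ge0 x; lra.
have := exprn_le_expR n y0; rewrite exprMn => h.
have {h} : (1 + x ^+ 2) ^+ n <=
    (8 / 3) ^+ n * n`!%:R * expR (3 / 8 * (1 + x ^+ 2)).
  rewrite -mulrA -ler_pdivrMl ?exprn_gt0 ?divr_gt0//.
  by rewrite -exprVn invf_div.
set K := _ * n`!%:R => h.
have -> : K * expR (3 / 8) * normal_peak 1 / normal_peak 2 *
    (normal_peak 2 * expR (- x ^+ 2 / (2 ^+ 2 *+ 2))) =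
    K * expR (3 / 8 * (1 + x ^+ 2)) * (normal_peak 1 * expR (- (x ^+ 2 / 2))).
  have -> : - x ^+ 2 / (2 ^+ 2 *+ 2) = 3 / 8 * x ^+ 2 + - (x ^+ 2 / 2).
    by field.
  by rewrite [3 / 8 * (1 + _)]mulrDr mulr1 !expRD; field.
by apply: ler_wpM2r => //; rewrite mulr_ge0 ?expR_ge0 ?normal_peak_ge0.
Qed.

End gaussian_density.

(** The weight [1 + x ^+ 2] is at least 1, so its powers increase with [n] and two bounds can be
    brought to a common exponent. *)
Definition poly_growth (R : realType) (f : R -> R) : Prop :=
  exists (C : R) (n : nat), forall x, `|f x| <= C * (1 + x ^+ 2) ^+ n.

Section poly_growth.
Context {R : realType}.
Implicit Types f g : R -> R.

Let one_le x : 1 <= 1 + x ^+ 2 :> R. Proof. by rewrite lerDl sqr_ge0. Qed.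

Lemma poly_growthP f : poly_growth f -> exists (C : R) (n : nat), 0 <= C /\
  forall x, `|f x| <= C * (1 + x ^+ 2) ^+ n.
Proof.
move=> [C [n h]]; exists C, n; split => //.
by have := h 0; rewrite expr0n addr0 expr1n mulr1; apply: le_trans.
Qed.

Lemma poly_growth_cst (c : R) : poly_growth (fun=> c).
Proof. by exists `|c|, 0%N => x; rewrite expr0 mulr1. Qed.

Lemma poly_growth_id : poly_growth (fun x : R => x).
Proof.
exists 1, 1%N => x; rewrite mul1r expr1 -(real_normK (num_real x)).
by have := sqr_ge0 (`|x| - 1); rewrite sqrrB1 mulr2n; have := normr_ge0 x; lra.
Qed.

Lemma poly_growthN f : poly_growth f -> poly_growth (fun x => - f x).
Proof. by move=> [C [n h]]; exists C, n => x; rewrite normrN. Qed.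

Lemma poly_growthD f g :
  poly_growth f -> poly_growth g -> poly_growth (fun x => f x + g x).
Proof.
move=> /poly_growthP[C [n [C0 h]]] /poly_growthP[D [m [D0 k]]].
exists (C + D), (n + m)%N => x; rewrite (le_trans (ler_normD _ _))// mulrDl lerD//.
  by apply: le_trans (h x) _; rewrite ler_wpM2l// ler_weXn2l// leq_addr.
by apply: le_trans (k x) _; rewrite ler_wpM2l// ler_weXn2l// leq_addl.
Qed.

Lemma poly_growthM f g :
  poly_growth f -> poly_growth g -> poly_growth (fun x => f x * g x).
Proof.
move=> /poly_growthP[C [n [C0 h]]] /poly_growthP[D [m [D0 k]]].
exists (C * D), (n + m)%N => x; rewrite normrM exprD mulrACA.
by rewrite ler_pM.
Qed.

Lemma poly_growth_compN f : poly_growth f -> poly_growth (fun x => f (- x)).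
Proof. by move=> [C [n h]]; exists C, n => x; rewrite -sqrrN. Qed.

(** One extra power of the weight is spent: [f * phi * (1 + x ^+ 2)] is still bounded, so [f * phi]
    decays like the inverse of the weight. *)
Lemma poly_growth_cvgy f : poly_growth f -> f x * phi x @[x --> +oo] --> 0.
Proof.
move=> /poly_growthP[C [n [C0 h]]]; have [D hD] := @phi_growth_le R n.+1.
have bnd x : `|f x * phi x| * (1 + x ^+ 2) <= C * `|D| * normal_peak 2.
  rewrite normrM (gtr0_norm (phi_gt0 x)).
  apply: (@le_trans _ _ (C * ((1 + x ^+ 2) ^+ n.+1 * phi x))).
    have -> : C * ((1 + x ^+ 2) ^+ n.+1 * phi x) =
        C * (1 + x ^+ 2) ^+ n * phi x * (1 + x ^+ 2) by rewrite exprSr; ring.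
    by rewrite ler_wpM2r ?(le_trans ler01)// ler_wpM2r// ltW// phi_gt0.
  rewrite -mulrA ler_wpM2l//; apply: le_trans (hD x) _.
  apply: (@le_trans _ _ (`|D| * normal_pdf 0 2 x)).
    by rewrite ler_wpM2r ?normal_pdf_ge0// ler_norm.
  by rewrite ler_wpM2l// normal_pdf_ub.
apply/cvgr0Pnorm_le => e e0; near=> x.
have x2 : 0 < 1 + x ^+ 2 by apply: lt_le_trans (one_le x).
rewrite -(ler_pM2r x2) (le_trans (bnd x))// -ler_pdivrMl//.
apply: (@le_trans _ _ x); last by have := sqr_ge0 (x - 1); nra.
by near: x; apply: nbhs_pinfty_ge; exact: num_real.
Unshelve. all: by end_near. Qed.

Lemma poly_growth_cvgNy f : poly_growth f -> f x * phi x @[x --> -oo] --> 0.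
Proof.
move=> /poly_growth_compN/poly_growth_cvgy h; apply/cvgNy_compNP.
by under eq_fun do rewrite /= phiN.
Qed.

Lemma poly_growth_integrable f : poly_growth f -> measurable_fun setT f ->
  mu.-integrable setT (fun x => (f x * phi x)%:E).
Proof.
move=> /poly_growthP[C [n [C0 h]]] mf; have [D hD] := @phi_growth_le R n.
have int2 : mu.-integrable setT (fun x : R => ((C * D) * normal_pdf 0 2 x)%:E).
  under eq_fun do rewrite EFinM.
  by apply: integrableZl => //; exact: integrable_normal_pdf.
apply: le_integrable int2 => //.
  apply/measurable_EFinP/measurable_funM => //; exact: measurable_normal_pdf.
move=> x _ /=; rewrite lee_fin normrM (gtr0_norm (phi_gt0 x)).
apply: le_trans (ler_norm _); rewrite -mulrA.
apply: (@le_trans _ _ (C * ((1 + x ^+ 2) ^+ n * phi x))).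
  by rewrite mulrA ler_wpM2r// ltW// phi_gt0.
by rewrite ler_wpM2l.
Qed.

End poly_growth.

(** Continuity gives measurability and growth gives integrability against [phi]. The class is closed
    under ring operations, so integrability can be checked by the shape of a formula. *)
Definition tame (R : realType) (f : R -> R) : Prop :=
  continuous f /\ poly_growth f.

Section tame.
Context {R : realType}.
Implicit Types f g : R -> R.

Lemma tame_cst (c : R) : tame (fun=> c).
Proof. by split; [exact: cst_continuous|exact: poly_growth_cst]. Qed.

Lemma tame_id : tame (fun x : R => x).
Proof. by split; [move=> x; exact: cvg_id|exact: poly_growth_id]. Qed.

Lemma tameN f : tame f -> tame (fun x => - f x).
Proof.
move=> [cf gf]; split; last exact: poly_growthN.
by move=> x; apply: cvgN; exact: cf.
Qed.

Lemma tameD f g : tame f -> tame g -> tame (fun x => f x + g x).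
Proof.
move=> [cf gf] [cg gg]; split; last exact: poly_growthD.
by move=> x; apply: cvgD; [exact: cf|exact: cg].
Qed.

Lemma tameM f g : tame f -> tame g -> tame (fun x => f x * g x).
Proof.
move=> [cf gf] [cg gg]; split; last exact: poly_growthM.
by move=> x; apply: cvgM; [exact: cf|exact: cg].
Qed.

Lemma tame_horner (p : {poly R}) : tame (fun x => p.[x]).
Proof.
elim/poly_ind: p => [|p c IH].
  by rewrite (_ : (fun _ => _) = fun=> 0); [exact: tame_cst|apply/funext => x; rewrite horner0].
rewrite (_ : (fun _ => _) = fun x => p.[x] * x + c); last first.
  by apply/funext => x; rewrite hornerMXaddC.
by apply: tameD; [apply: tameM => //; exact: tame_id|exact: tame_cst].
Qed.

Lemma tame_integrable f : tame f -> mu.-integrable setT (fun x => (f x * phi x)%:E).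
Proof.
by move=> [cf gf]; apply: poly_growth_integrable => //; exact: continuous_measurable_fun.
Qed.

Lemma continuous_mul_phi f : continuous f -> continuous (fun x => f x * phi x).
Proof.
by move=> cf x; apply: cvgM; [exact: cf|exact: is_derive_continuous (is_derive_phi x)].
Qed.

End tame.

(* Syntactic matching: plain [apply:] would try to unfold the operations. *)
Ltac solve_tame := repeat lazymatch goal with
  | |- tame (fun _ => ?c) => exact: tame_cst
  | |- tame (fun x => x) => exact: tame_id
  | |- tame (fun x => @Algebra.add _ (@?f x) (@?g x)) => apply: (@tameD _ f g)
  | |- tame (fun x => @Algebra.opp _ (@?f x)) => apply: (@tameN _ f)
  | |- tame (fun x => @GRing.mul _ (@?f x) (@?g x)) => apply: (@tameM _ f g)
  | |- _ => assumption
  end.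

(** * Gaussian integration by parts *)

Section improper_integrals.
Context {R : realType}.
Implicit Types f : R -> R.

(** Dominated convergence with majorant [|f|]: at each point, membership in [A n] eventually agrees
    with membership in [D]. This serves the limits of the primitive at both ends of the line. *)
Lemma cvg_Rintegral_sets f (A : nat -> set R) (D : set R) :
  mu.-integrable setT (EFin \o f) ->
  (forall n, measurable (A n)) -> measurable D ->
  (forall x, \forall n \near \oo, A n x <-> D x) ->
  \int[mu]_(x in A n) f x @[n --> \oo] --> \int[mu]_(x in D) f x.
Proof.
move=> intf mA mD AD; rewrite [X in _ --> X]Rintegral_mkcond.
under eq_fun do rewrite Rintegral_mkcond.
have mf : measurable_fun setT f by apply/measurable_EFinP; apply: measurable_int intf.
have mr B : measurable B -> measurable_fun setT (EFin \o (f \_ B)).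
  move=> mB; apply/measurable_EFinP; apply/(measurable_restrictT f) => //.
  exact: measurable_funTS.
have intD : mu.-integrable setT (EFin \o (f \_ D)).
  rewrite -restrict_EFin; apply/(integrable_restrict _ _ _) => //.
  by rewrite setTI; apply: integrableS intf.
have patch_cvg x : (f \_ (A n)) x @[n --> \oo] --> (f \_ D) x.
  apply: cvg_near_cst; apply: filterS (AD x) => n AnD; rewrite !patchE.
  by congr (if _ then _ else _); apply/idP/idP; rewrite !inE => /AnD.
have aecvg : {ae mu, forall x, setT x ->
    (EFin \o (f \_ (A n))) x @[n --> \oo] --> (EFin \o (f \_ D)) x}.
  by apply: aeW => x _; apply: cvg_comp (patch_cvg x) _; exact: cvg_id.
have aedom : {ae mu, forall x n, setT x ->
    (`|(EFin \o (f \_ (A n))) x| <= `|f x|%:E)%E}.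
  apply: aeW => x n _ /=; rewrite lee_fin patchE.
  by case: ifP => // _; rewrite normr0.
have intnf : mu.-integrable setT (fun x => `|f x|%:E).
  exact: (integrable_abse intf).
have [_ _] := @dominated_convergence _ _ R mu setT measurableT
  (fun n => EFin \o (f \_ (A n))) (EFin \o (f \_ D)) (fun x => `|f x|%:E)
  (fun n => mr _ (mA n)) (mr _ mD) aecvg intnf aedom.
move=> h; apply: fine_cvg; rewrite fineK//.
exact: integrable_fin_num.
Qed.

Lemma cvg_Rintegral_itvNy_y f : mu.-integrable setT (EFin \o f) ->
  \int[mu]_(t in `]-oo, x]) f t @[x --> +oo] --> \int[mu]_t f t.
Proof.
move=> intf; apply/cvg_pinftyP => u uy.
apply: cvg_Rintegral_sets => // x.
near=> n; split => // _; rewrite /= in_itv/=.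
by near: n; move/cvgryPge : uy; exact.
Unshelve. all: by end_near. Qed.

Lemma cvg_Rintegral_itvNy_Ny f : mu.-integrable setT (EFin \o f) ->
  \int[mu]_(t in `]-oo, x]) f t @[x --> -oo] --> (0 : R).
Proof.
move=> intf; apply/cvg_ninftyP => u uNy.
(* Every point eventually leaves the half-lines, so the limit set is empty. *)
rewrite -(Rintegral_set0 mu f); apply: cvg_Rintegral_sets => // x.
near=> n; split => //; rewrite /= in_itv/= leNgt => /negP; apply.
by near: n; move/cvgrNyPlt : uNy; exact.
Unshelve. all: by end_near. Qed.

Lemma is_derive_Rintegral_itvNy f x : mu.-integrable setT (EFin \o f) ->
  {for x, continuous f} ->
  is_derive x 1 (fun y => \int[mu]_(t in `]-oo, y]) f t) (f x).
Proof.
move=> intf cf.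
have xu : x < x + 1 by rewrite ltrDl.
have iu : mu.-integrable `]-oo, x + 1] (EFin \o f) by apply: integrableS intf.
have [d <-] := continuous_FTC1 xu iu (ltNyr x) cf.
by rewrite derive1E; exact/derivableP.
Qed.

End improper_integrals.

(* The integrand is [(a phi)']. *)
Lemma integral_gauss_deriv (R : realType) (a a' : R -> R) :
  (forall x : R, is_derive x 1 a (a' x)) -> poly_growth a -> tame a' ->
  \int[mu]_x ((a' x - x * a x) * phi x) = 0.
Proof.
move=> da ga ta'; set h := fun x => (a' x - x * a x) * phi x.
have ta : tame a by split => // x; exact: is_derive_continuous (da x).
have tb : tame (fun x => a' x - x * a x) by solve_tame.
have ch : continuous h by apply: continuous_mul_phi; exact: tb.1.
have inth : mu.-integrable setT (EFin \o h) by exact: tame_integrable.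
pose I x := \int[mu]_(t in `]-oo, x]) h t.
(* [k] is constant; its limit is 0 at -oo and the full integral at +oo. *)
pose k x := I x - a x * phi x.
have dk (x : R) : is_derive x 1 k 0.
  have dI := is_derive_Rintegral_itvNy inth (ch x).
  have dp := is_derive_phi x; have dax := da x.
  apply: is_derive_eq; rewrite /GRing.scale/= /h; ring.
have kE x : k x = k 0 by exact: is_derive_0_is_cst.
have cstE (F : set_system R) (l : R) : ProperFilter F ->
    k x @[x --> F] --> l -> k 0 = l.
  move=> PF; under eq_fun do rewrite kE.
  by move=> kl; rewrite -(cvg_lim _ kl)// lim_cst.
have k0 : k 0 = 0.
  apply: (cstE -oo%R); rewrite -[X in _ --> X]subr0.
  by apply: cvgB; [exact: cvg_Rintegral_itvNy_Ny|exact: poly_growth_cvgNy].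
rewrite -k0; apply/esym/(cstE +oo%R); rewrite -[X in _ --> X]subr0.
by apply: cvgB; [exact: cvg_Rintegral_itvNy_y|exact: poly_growth_cvgy].
Qed.

(** * A priori bounds for the Stein equation *)

Definition sup_finite (R : realType) (f : R -> R) : Prop :=
  exists C, forall x, `|f x| <= C.

(** This is the growth allowed for [g] in [u' = x u + g] when bounding [u]: the term [x * u] can
    compensate it. *)
Definition linear_growth (R : realType) (f : R -> R) : Prop :=
  exists2 C, 0 <= C & forall x, `|f x| <= C * (1 + `|x|).

Section growth.
Context {R : realType}.
Implicit Types f g : R -> R.

Lemma sup_finite_linear f : sup_finite f -> linear_growth f.
Proof.
move=> [C h]; have C0 : 0 <= C by apply: le_trans (h 0).
exists C => // x; apply: le_trans (h x) _.
by rewrite mulrDr mulr1 lerDl mulr_ge0.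
Qed.

Lemma sup_finite_linear_idM f : sup_finite f -> linear_growth (fun x => x * f x).
Proof.
move=> [C h]; have C0 : 0 <= C by apply: le_trans (h 0).
exists C => // x; rewrite normrM mulrC ler_pM// lerDr//.
Qed.

Lemma linear_growthD f g :
  linear_growth f -> linear_growth g -> linear_growth (fun x => f x + g x).
Proof.
move=> [C C0 hC] [D D0 hD]; exists (C + D); first exact: addr_ge0.
by move=> x; rewrite (le_trans (ler_normD _ _))// mulrDl lerD.
Qed.

Lemma linear_poly_growth f : linear_growth f -> poly_growth f.
Proof.
move=> [C C0 h]; exists (2 * C), 1%N => x; apply: le_trans (h x) _.
rewrite expr1 -(real_normK (num_real x)).
have := sqr_ge0 (`|x| - 1); rewrite sqrrB1 mulr2n => x1.
by rewrite mulrAC mulrC; rewrite ler_wpM2r//; have := normr_ge0 x; nra.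
Qed.

Lemma sup_finiteD f g :
  sup_finite f -> sup_finite g -> sup_finite (fun x => f x + g x).
Proof.
move=> [C hC] [D hD]; exists (C + D) => x.
by rewrite (le_trans (ler_normD _ _))// lerD.
Qed.

Lemma sup_finiteZ (c : R) f : sup_finite f -> sup_finite (fun x => c * f x).
Proof. by move=> [C hC]; exists (`|c| * C) => x; rewrite normrM ler_wpM2l. Qed.

(** By the mean value theorem. It supplies the growth of [F], of which only the derivatives are
    assumed bounded. *)
Lemma sup_finite_derive_linear f g :
  (forall x : R, is_derive x 1 f (g x)) -> sup_finite g -> linear_growth f.
Proof.
move=> df [C h]; have C0 : 0 <= C by apply: le_trans (h 0).
exists (`|f 0| + C); first exact: addr_ge0.
move=> x; have cf (a b : R) : {within `[a, b], continuous f}.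
  apply: derivable_within_continuous => y _; exact: (@ex_derive _ _ _ _ _ _ _ (df y)).
suff : `|f x - f 0| <= C * `|x|.
  have := ler_normD (f x - f 0) (f 0); rewrite subrK.
  by have := normr_ge0 (f 0); have := normr_ge0 x; nra.
have [x0|/ltW x0] := leP 0 x.
  have [c _ ->] := MVT_segment x0 (fun y _ => df y) (cf _ _).
  by rewrite subr0 normrM ler_wpM2r.
rewrite distrC.
have [c _ ->] := MVT_segment x0 (fun y _ => df y) (cf _ _).
by rewrite sub0r normrM normrN ler_wpM2r.
Qed.

End growth.

(* [(u + 2 M) phi] is nonincreasing on [1, +oo[ and tends to 0. *)
Lemma stein_ode_lower_bound (R : realType) (u g : R -> R) (M : R) :
  0 <= M -> (forall x : R, is_derive x 1 u (x * u x + g x)) ->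
  (forall x, 0 <= x -> g x <= M * (1 + x)) ->
  u x * phi x @[x --> +oo] --> (0 : R) ->
  forall x, 1 <= x -> - (2 * M) <= u x.
Proof.
move=> M0 du gM u0 x x1; pose v y := (u y + 2 * M) * phi y.
(* As [phi' = - y phi], the term [y * u] cancels; for [1 <= y] the rest is nonpositive because
   [g y <= M * (1 + y) <= 2 * M * y]. *)
have dv (y : R) : is_derive y 1 v ((g y - 2 * M * y) * phi y).
  have dp := is_derive_phi y; have duy := du y.
  apply: is_derive_eq; rewrite /GRing.scale/=; ring.
have dcv y : y \in `]1, +oo[ -> derivable v y 1.
  by move=> _; exact: (@ex_derive _ _ _ _ _ _ _ (dv y)).
have vnincr := ler0_derive1_nincry dcv.
have v0 : v y @[y --> +oo] --> (0 : R).
  rewrite -[0]addr0; under eq_fun do rewrite /v mulrDl.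
  by apply: cvgD => //; apply: poly_growth_cvgy; exact: poly_growth_cst.
(* If [v x] were negative, monotonicity would keep [v] below [v x] on the right of [x], against its
   limit 0. *)
rewrite leNgt; apply/negP => ux.
have vx : v x < 0 by rewrite /v pmulr_llt0 ?phi_gt0//; lra.
have nvx : 0 < - v x by rewrite oppr_gt0.
have nv : \forall y \near +oo, `|v y| < - v x.
  by move/cvgr0Pnorm_lt : v0 => /(_ _ nvx).
have [y [xy vy]] : exists y, x <= y /\ `|v y| < - v x.
  near (+oo%R : set_system R) => y; exists y; split.
    by near: y; apply: nbhs_pinfty_ge; exact: num_real.
  by near: y.
have : v y <= v x.
  apply: vnincr => //.
  - move=> z; rewrite in_itv/= andbT => z1.
    rewrite (is_derive_derive1 (dv z)) pmulr_lle0 ?phi_gt0// subr_le0.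
    by apply: le_trans (gM z _) _; [lra|nra].
  - apply: derivable_within_continuous => z _.
    exact: (@ex_derive _ _ _ _ _ _ _ (dv z)).
by move: vy; rewrite ltr_norml => /andP[]; lra.
Unshelve. all: by end_near. Qed.

(** The lower bound is applied to [u] and [- u], and to their reflections, which solve equations of
    the same form; this bounds [u] by [2 * M] outside []-1, 1[], and continuity bounds it inside.
    The two limits exclude the homogeneous solution [exp (x^2 / 2)]. *)
Lemma stein_ode_bounded (R : realType) (u g : R -> R) :
  (forall x : R, is_derive x 1 u (x * u x + g x)) -> linear_growth g ->
  u x * phi x @[x --> +oo] --> (0 : R) -> u x * phi x @[x --> -oo] --> (0 : R) ->
  sup_finite u.
Proof.
move=> du [M M0 gM] uy uNy.
have cvgN0 (w : R -> R) : w x * phi x @[x --> +oo] --> (0 : R) ->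
    - w x * phi x @[x --> +oo] --> (0 : R).
  have -> : (fun x => - w x * phi x) = (fun x => - (w x * phi x)).
    by apply/funext => x; rewrite mulNr.
  by move/cvgN; rewrite oppr0.
have gM0 x : 0 <= x -> `|g x| <= M * (1 + x) /\ `|g (- x)| <= M * (1 + x).
  move=> x0; split; first by have := gM x; rewrite (ger0_norm x0).
  by have := gM (- x); rewrite normrN (ger0_norm x0).
have lb1 := stein_ode_lower_bound M0 du
  (fun x x0 => le_trans (ler_norm _) (gM0 x x0).1) uy.
have lb2 : forall x, 1 <= x -> - (2 * M) <= - u x.
  apply: (@stein_ode_lower_bound _ (fun x => - u x) (fun x => - g x)) => //.
  - by move=> x; have dux := du x; apply: is_derive_eq; lra.
  - by move=> x x0; apply: le_trans (gM0 x x0).1; rewrite -normrN ler_norm.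
  - exact: cvgN0 uy.
have uNy' : u (- x) * phi x @[x --> +oo] --> (0 : R).
  move/cvgNy_compNP : uNy; apply: cvg_trans; apply: near_eq_cvg.
  by near=> x; rewrite /= phiN.
have duN (x : R) : is_derive x 1 (fun y => u (- y)) (x * u (- x) - g (- x)).
  have dux := du (- x).
  have dN : is_derive x 1 (-%R : R -> R) (-1) by exact: is_deriveNid.
  apply: is_derive_eq (is_derive_comp_fun dux dN) _; ring.
have lb3 : forall x, 1 <= x -> - (2 * M) <= u (- x).
  apply: (@stein_ode_lower_bound _ (fun x => u (- x)) (fun x => - g (- x))) => //.
  by move=> x x0; apply: le_trans (gM0 x x0).2; rewrite -normrN ler_norm.
have lb4 : forall x, 1 <= x -> - (2 * M) <= - u (- x).
  apply: (@stein_ode_lower_bound _ (fun x => - u (- x)) (fun x => g (- x))) => //.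
  - by move=> x; have duNx := duN x; apply: is_derive_eq; lra.
  - by move=> x x0; apply: le_trans (gM0 x x0).2; exact: ler_norm.
  - exact: cvgN0 uNy'.
have cu : continuous u by move=> x; exact: is_derive_continuous (du x).
have [c _ uc] : exists2 c, c \in `[(-1 : R), 1] &
    forall t, t \in `[(-1 : R), 1] -> `|u t| <= `|u c|.
  apply: (@EVT_max R (fun t => `|u t|)); first lra.
  by apply: continuous_subspaceT => t; apply: cvg_norm; exact: cu.
exists (2 * M + `|u c|) => x.
have [x1|x1] := leP 1 x.
  by have := lb1 _ x1; have := lb2 _ x1; have := normr_ge0 (u c);
    rewrite ler_norml => *; lra.
have [xN1|xN1] := leP x (-1).
  have x1' : 1 <= - x by lra.
  have := lb3 _ x1'; have := lb4 _ x1'; have := normr_ge0 (u c).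
  by rewrite opprK ler_norml => *; lra.
apply: le_trans (uc x _) _; last by rewrite lerDr mulr_ge0.
by rewrite in_itv/= !ltW.
Unshelve. all: by end_near. Qed.

(** * The Stein equation *)

(** A real-valued Lebesgue integral, the form in which integration by parts is available;
    [integral_gauss_mean] relates it to [normal_prob] for tame functions. *)
Definition gauss_mean (R : realType) (f : R -> R) : R :=
  \int[mu]_x (f x * phi x).

Section gauss_mean.
Context {R : realType}.
Implicit Types f g : R -> R.

Lemma gauss_mean_cst (c : R) : gauss_mean (fun=> c) = c.
Proof.
rewrite /gauss_mean RintegralZl//; last exact: integrable_normal_pdf.
by rewrite /Rintegral integral_normal_pdf mulr1.
Qed.

Lemma gauss_meanD f g : tame f -> tame g ->
  gauss_mean (fun x => f x + g x) = gauss_mean f + gauss_mean g.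
Proof.
move=> tf tg; rewrite /gauss_mean -RintegralD//.
- by apply: eq_Rintegral => x _; rewrite mulrDl.
- exact: tame_integrable.
- exact: tame_integrable.
Qed.

Lemma gauss_meanZ (c : R) f : tame f ->
  gauss_mean (fun x => c * f x) = c * gauss_mean f.
Proof.
move=> tf; rewrite /gauss_mean -RintegralZl//.
- by apply: eq_Rintegral => x _; rewrite mulrA.
- exact: tame_integrable.
Qed.

Lemma integral_gauss_mean f : tame f ->
  (\int[gauss]_x (f x)%:E = (gauss_mean f)%:E)%E.
Proof.
move=> tf; have mf : measurable_fun setT f.
  by apply: continuous_measurable_fun; exact: tf.1.
have intf := tame_integrable tf.
by rewrite integral_gauss// /gauss_mean fineK//; exact: integrable_fin_num.
Qed.

End gauss_mean.

Section stein_equation.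
Context {R : realType}.
Implicit Types f G : R -> R.

(* [f = I / phi], where [I] is the primitive of [(G - gauss_mean G) phi]
   vanishing at -oo, hence also at +oo. *)
Lemma stein_solution G : continuous G -> linear_growth G ->
  exists2 f, (forall x : R, is_derive x 1 f (x * f x + (G x - gauss_mean G))) &
    sup_finite f.
Proof.
move=> cG gG; set c := gauss_mean G.
have lGc : linear_growth (fun x => G x - c).
  apply: linear_growthD => //; apply: sup_finite_linear.
  by exists `|- c| => x.
pose h x := (G x - c) * phi x.
have tG : tame G by split => //; exact: linear_poly_growth.
have tGc : tame (fun x => G x - c) by solve_tame.
have ch : continuous h by apply: continuous_mul_phi; exact: tGc.1.
have inth : mu.-integrable setT (EFin \o h) by exact: tame_integrable.
have h0 : \int[mu]_x h x = 0.
  transitivity (gauss_mean G + gauss_mean (fun=> - c)).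
    by rewrite -gauss_meanD//; exact: tame_cst.
  by rewrite gauss_mean_cst subrr.
pose I x := \int[mu]_(t in `]-oo, x]) h t.
pose f x := I x * (phi x)^-1.
have p0 (x : R) : phi x != 0 by rewrite gt_eqF// phi_gt0.
have fI x : f x * phi x = I x by rewrite /f mulfVK.
(* The term [x * f x] comes from [(1 / phi)' = x / phi]. *)
have df (x : R) : is_derive x 1 f (x * f x + (G x - c)).
  have dI : is_derive x 1 I (h x) := is_derive_Rintegral_itvNy inth (ch x).
  have dp := is_derive_phi x.
  have dVp := is_deriveV (p0 x) dp.
  apply: is_derive_eq (is_deriveM_fun dI dVp) _.
  by have := p0 x; rewrite /f /h /GRing.scale/= => pn0; field.
exists f => //; apply: stein_ode_bounded df lGc _ _.
- under eq_fun do rewrite fI; rewrite -h0.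
  exact: cvg_Rintegral_itvNy_y.
- under eq_fun do rewrite fI.
  exact: cvg_Rintegral_itvNy_Ny.
Qed.

(* Each derivative [u] of the Stein solution solves again
   [u' = x u + g], where [g] has at most linear growth. *)
Lemma stein_solution_derivatives G G1 G2 :
  (forall x : R, is_derive x 1 G (G1 x)) ->
  (forall x : R, is_derive x 1 G1 (G2 x)) ->
  sup_finite G1 -> linear_growth G2 ->
  exists f f1 f2, [/\ (forall x : R, is_derive x 1 f (f1 x)),
    (forall x : R, is_derive x 1 f1 (f2 x)),
    (forall x : R, is_derive x 1 f2 (x * f2 x + (2 * f1 x + G2 x))),
    [/\ sup_finite f, sup_finite f1 & sup_finite f2] &
    forall x, f1 x = x * f x + (G x - gauss_mean G)].
Proof.
move=> dG dG1 bG1 lG2.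
have lG := sup_finite_derive_linear dG bG1.
have cG : continuous G by move=> x; exact: is_derive_continuous (dG x).
have [f df bf] := stein_solution cG lG.
pose f1 x := x * f x + (G x - gauss_mean G).
have df1 (x : R) : is_derive x 1 f1 (x * f1 x + (f x + G1 x)).
  have dfx := df x; have dGx := dG x.
  by apply: is_derive_eq; rewrite /GRing.scale/= /f1; ring.
have vanish u : linear_growth u ->
    u x * phi x @[x --> +oo] --> (0 : R) /\ u x * phi x @[x --> -oo] --> (0 : R).
  move=> /linear_poly_growth gu; split; first exact: poly_growth_cvgy.
  exact: poly_growth_cvgNy.
(* Bootstrap: the formula for [f1] gives linear growth, hence the decay of [f1 * phi] at both ends;
   the equation solved by [f1] then improves this to boundedness. The same is done for [f2]. *)
have lf1 : linear_growth f1.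
  apply: linear_growthD; first exact: sup_finite_linear_idM.
  apply: linear_growthD => //; apply: sup_finite_linear.
  by exists `|- gauss_mean G|.
have bf1 : sup_finite f1.
  have [y Ny] := vanish _ lf1; apply: stein_ode_bounded df1 _ y Ny.
  exact: sup_finite_linear (sup_finiteD bf bG1).
pose f2 x := x * f1 x + (f x + G1 x).
have df2 (x : R) : is_derive x 1 f2 (x * f2 x + (2 * f1 x + G2 x)).
  have dfx := df x; have dGx := dG1 x; have dfx1 := df1 x.
  by apply: is_derive_eq; rewrite /GRing.scale/= /f2 /f1; ring.
have lf2 : linear_growth f2.
  apply: linear_growthD; first exact: sup_finite_linear_idM.
  exact: sup_finite_linear (sup_finiteD bf bG1).
have bf2 : sup_finite f2.
  have [y Ny] := vanish _ lf2; apply: stein_ode_bounded df2 _ y Ny.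
  apply: linear_growthD => //.
  by apply: sup_finite_linear; exact: sup_finiteZ.
by exists f, f1, f2.
Qed.

(** One more turn of the bootstrap, kept apart because it uses a bounded third derivative of the
    source: [F] has one, while the source [f2] of the second Stein equation is not known to. *)
Lemma stein_solution_third_derivative G3 f2 f3 :
  (forall x : R, is_derive x 1 f3 (x * f3 x + (3 * f2 x + G3 x))) ->
  linear_growth f3 -> sup_finite f2 -> sup_finite G3 -> sup_finite f3.
Proof.
move=> df3 /linear_poly_growth gf3 bf2 bG3.
apply: stein_ode_bounded df3 _ _ _.
- by apply: sup_finite_linear; apply: sup_finiteD => //; exact: sup_finiteZ.
- exact: poly_growth_cvgy.
- exact: poly_growth_cvgNy.
Qed.

End stein_equation.

(** * Poisson integrals *)

Section poisson.
Context {R : realType} (l : R) (l0 : 0 < l).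

Local Notation Q := (poisson_prob l 0%N).

Lemma ge0_integral_poisson (h : nat -> \bar R) : (forall k, 0 <= h k)%E ->
  (\int[Q]_k h k = \sum_(0 <= k <oo) (h k * (poisson_pmf l k)%:E))%E.
Proof.
move=> h0; have <- : \bigcup_k [set k] = [set: nat].
  by apply/seteqP; split => // k _; exists k.
rewrite ge0_integral_bigcup//; last first.
  by apply/trivIsetP => i j _ _ ij; apply/seteqP; split => // k [/= -> /eqP]; rewrite (negbTE ij).
apply: eq_eseriesr => k _.
rewrite (eq_integral (cst (h k))); last by move=> x; rewrite inE => ->.
rewrite integral_cst//=; congr (_ * _)%E.
by rewrite /poisson_prob l0 esum_set1// lee_fin poisson_pmf_ge0.
Qed.

(** The recursion behind the identity [E Z h(Z) = l E h(Z + 1)]. *)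
Lemma poisson_pmfS (k : nat) :
  k.+1%:R * poisson_pmf l k.+1 = l * poisson_pmf l k.
Proof.
rewrite /poisson_pmf l0 factS natrM exprS.
have f0 : k`!%:R != 0 :> R by rewrite pnatr_eq0 -lt0n fact_gt0.
have k0 : k.+1%:R != 0 :> R by rewrite pnatr_eq0.
move: (k.+1%:R) (k`!%:R) k0 f0 => a b a0 b0.
by field; apply/andP; split.
Qed.

Lemma ge0_integral_poisson_idM (h : nat -> R) : (forall k, 0 <= h k) ->
  (\int[Q]_k (k%:R * h k)%:E = l%:E * \int[Q]_k (h k.+1)%:E)%E.
Proof.
move=> h0; rewrite !ge0_integral_poisson; last 2 first.
- by move=> k; rewrite lee_fin.
- by move=> k; rewrite lee_fin mulr_ge0.
rewrite -nneseriesZl; last first.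
  by move=> k _; rewrite mule_ge0// lee_fin// poisson_pmf_ge0.
have ge0 k : (0 <= (k%:R * h k)%:E * (poisson_pmf l k)%:E)%E.
  by rewrite mule_ge0// lee_fin ?mulr_ge0// poisson_pmf_ge0.
(* The term of index 0 carries the factor [0%:R]; the remaining series is reindexed from 1. *)
rewrite nneseries_recl// -(nneseries_addn 1)//.
rewrite mul0r mul0e add0e; apply: eq_eseriesr => k _; rewrite addn1.
by rewrite -!EFinM; congr EFin; rewrite mulrAC poisson_pmfS; ring.
Qed.

Lemma poisson_integrable (h : nat -> R) (A B : R) :
  (forall k, `|h k| <= A + B * k%:R) -> Q.-integrable setT (EFin \o h).
Proof.
move=> hAB; apply: (@le_integrable _ _ _ _ _ _ _ (fun k => (`|A| + `|B| * k%:R)%:E)) => //.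
  move=> k _ /=; rewrite lee_fin; apply: le_trans (ler_norm _).
  by rewrite (le_trans (hAB k))// lerD ?ler_norm// ler_wpM2r// ler_norm.
have int1 : Q.-integrable setT (fun k => k%:R%:E).
  apply/integrableP; split => //.
  (* With [h = 1] the identity computes the mean as [l], which is finite. *)
  have := @ge0_integral_poisson_idM (cst 1) (fun=> ler01).
  have -> : (\int[Q]_k (cst 1 k.+1)%:E = 1)%E.
    by rewrite (integral_cst _ _ 1%E)// mul1e; exact: probability_setT.
  rewrite mule1 => e; rewrite (_ : (\int[_]_x _ = l%:E)%E) ?ltry// -e.
  by apply: eq_integral => k _; rewrite /= mulr1 ger0_norm.
apply: (@eq_integrable _ _ _ _ _ _ (fun k => `|A|%:E + `|B|%:E * k%:R%:E)%E) => //.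
  by apply: integrableD => //; [exact: finite_measure_integrable_cst|exact: integrableZl].
Qed.

Lemma Rintegral_poisson_cst (c : R) : \int[Q]_k c = c.
Proof. by rewrite Rintegral_cst//= (_ : Q setT = 1%E) ?mulr1//; exact: probability_setT. Qed.

Lemma poisson_integrable_bounded (h : nat -> R) (A : R) :
  (forall k, `|h k| <= A) -> Q.-integrable setT (EFin \o h).
Proof.
by move=> hA; apply: (@poisson_integrable _ A 0) => k; rewrite mul0r addr0.
Qed.

Lemma normr_Rintegral_poisson_le (h : nat -> R) (A : R) :
  (forall k, `|h k| <= A) -> `|\int[Q]_k h k| <= A.
Proof.
move=> hA; have inth := poisson_integrable_bounded hA.
rewrite (le_trans (le_normr_Rintegral _ _))// -[leRHS]Rintegral_poisson_cst.
apply: le_Rintegral => //.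
- exact: (integrable_norm inth).
- by apply: (@poisson_integrable_bounded _ `|A|) => k.
Qed.

(** The nonnegative case applies to [h + A] and to the constant [A]; the difference of the two
    identities is the claim. *)
Lemma Rintegral_poisson_idM (h : nat -> R) (A : R) :
  (forall k, `|h k| <= A) ->
  \int[Q]_k (k%:R * h k) = l * \int[Q]_k h k.+1.
Proof.
move=> hA.
have A0 : 0 <= A by apply: le_trans (hA 0%N).
have ge0 k : 0 <= h k + A by have := hA k; rewrite ler_norml => /andP[]; lra.
have idM (g : nat -> R) : (forall k, 0 <= g k) ->
    (forall k, `|g k| <= A + A) ->
    \int[Q]_k (k%:R * g k) = l * \int[Q]_k g k.+1.
  move=> g0 gA; rewrite /Rintegral ge0_integral_poisson_idM// fineM//.
  apply: integrable_fin_num => //.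
  by apply: (@poisson_integrable_bounded _ (A + A)) => k; exact: gA.
have intk (g : nat -> R) : (forall k, `|g k| <= A + A) ->
    Q.-integrable setT (EFin \o (fun k => k%:R * g k)).
  move=> gA; apply: (@poisson_integrable _ 0 (A + A)) => k.
  by rewrite add0r normrM mulrC ler_pM// ger0_norm.
have hA2 k : `|h k| <= A + A by apply: le_trans (hA k) _; lra.
have AA2 (k : nat) : `|A| <= A + A by rewrite ger0_norm//; lra.
have hAA2 k : `|h k + A| <= A + A.
  by rewrite (le_trans (ler_normD _ _))// lerD// ger0_norm.
have := idM _ ge0 hAA2; have := idM (fun=> A) (fun=> A0) AA2.
under [in X in _ -> X -> _]eq_Rintegral do rewrite mulrDr.
rewrite RintegralD//; last 2 first.
- by apply: (@poisson_integrable_bounded _ A) => k; exact: hA.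
- by apply: (@poisson_integrable_bounded _ (A + A)) => k; exact: AA2.
rewrite RintegralD//; [|exact: intk|exact: (intk (fun=> A))].
by move=> e; rewrite mulrDr -e => /addIr.
Qed.

End poisson.

(** * Stein's identity for the standardized Poisson law *)

Section taylor.
Context {R : realType}.
Implicit Types f : R -> R.

Lemma is_derive_shift_fun f f1 (x t : R) :
  (forall y : R, is_derive y 1 f (f1 y)) ->
  is_derive t 1 (fun t => f (x + t)) (f1 (x + t)).
Proof.
move=> df.
have ds : is_derive t 1 (fun t : R => x + t) (1 : R).
  apply: is_derive_eq (is_deriveD_fun (is_derive_cst_fun x t) (is_derive_id_fun t)) _.
  by rewrite add0r.
by apply: is_derive_eq (is_derive_comp_fun (df (x + t)) ds) _; rewrite mulr1.
Qed.

Lemma derive_bound_itv0 (r r1 : R -> R) (K h : R) :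
  (forall t : R, is_derive t 1 r (r1 t)) -> r 0 = 0 -> 0 <= h ->
  (forall t, 0 <= t <= h -> `|r1 t| <= K) -> `|r h| <= K * h.
Proof.
move=> dr r0 h0 hK.
have cr : {within `[0, h], continuous r}.
  apply: derivable_within_continuous => y _.
  exact: (@ex_derive _ _ _ _ _ _ _ (dr y)).
have [c cI] := MVT_segment h0 (fun y _ => dr y) cr.
by rewrite r0 !subr0 => ->; rewrite normrM (ger0_norm h0) ler_wpM2r// hK.
Qed.

Lemma taylor1_bound f f1 f2 (M x h : R) :
  (forall y : R, is_derive y 1 f (f1 y)) ->
  (forall y : R, is_derive y 1 f1 (f2 y)) ->
  (forall y, `|f2 y| <= M) -> 0 <= h ->
  `|f (x + h) - f x - h * f1 x| <= M * h ^+ 2.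
Proof.
move=> df df1 f2M h0; rewrite expr2 mulrA.
have M0 : 0 <= M by apply: le_trans (f2M 0).
apply: (@derive_bound_itv0 (fun t => f (x + t) - f x - t * f1 x)
  (fun t => f1 (x + t) - f1 x)) => //.
- move=> t; have dft := is_derive_shift_fun x t df.
  by apply: is_derive_eq; rewrite /GRing.scale/=; ring.
- by rewrite addr0 mul0r !subrr.
move=> t /andP[t0 th]; apply: (@le_trans _ _ (M * t)); last by rewrite ler_wpM2l.
apply: (@derive_bound_itv0 (fun t => f1 (x + t) - f1 x) (fun t => f2 (x + t))) => //.
- move=> u; have dfu := is_derive_shift_fun x u df1.
  by apply: is_derive_eq; rewrite subr0.
- by rewrite addr0 subrr.
Qed.

(** Differentiating the remainder in [h] gives the first-order remainder of [f1], so [taylor1_bound]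
    and the mean value inequality conclude. The factorial gain is given up, which only affects the
    final constant. *)
Lemma taylor2_bound f f1 f2 f3 (M x h : R) :
  (forall y : R, is_derive y 1 f (f1 y)) ->
  (forall y : R, is_derive y 1 f1 (f2 y)) ->
  (forall y : R, is_derive y 1 f2 (f3 y)) ->
  (forall y, `|f3 y| <= M) -> 0 <= h ->
  `|f (x + h) - f x - h * f1 x - h ^+ 2 / 2 * f2 x| <= M * h ^+ 3.
Proof.
move=> df df1 df2 f3M h0; rewrite [h ^+ 3]exprSr mulrA.
have M0 : 0 <= M by apply: le_trans (f3M 0).
apply: (@derive_bound_itv0
  (fun t => f (x + t) - f x - t * f1 x - t ^+ 2 / 2 * f2 x)
  (fun t => f1 (x + t) - f1 x - t * f2 x)) => //.
- move=> t; have dft := is_derive_shift_fun x t df.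
  by apply: is_derive_eq; rewrite /GRing.scale/=; field.
- by rewrite addr0 expr0n !mul0r !subrr.
move=> t /andP[t0 th]; apply: (@le_trans _ _ (M * t ^+ 2)).
  exact: (taylor1_bound x df1 df2).
by rewrite ler_wpM2l// lerXn2r// nnegrE// (le_trans t0).
Qed.

End taylor.

Section poisson_stein.
Context {R : realType} (l : R) (l0 : 0 < l).
Implicit Types f G : R -> R.

Local Notation Q := (poisson_prob l 0%N).
Local Notation s := (Num.sqrt l).
Local Notation X := (standardize l).

Let s0 : 0 < s. Proof. by rewrite sqrtr_gt0. Qed.

Let ss : s * s = l. Proof. by rewrite -expr2 sqr_sqrtr// ltW. Qed.

Let sl : s^-1 * l = s.
Proof. by rewrite -[X in _ * X]ss mulKf// gt_eqF. Qed.

Lemma standardizeS k : X k.+1 = X k + s^-1.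
Proof. by rewrite /standardize -natr1; field; rewrite gt_eqF. Qed.

Lemma poisson_integrable_linear f : linear_growth f ->
  Q.-integrable setT (EFin \o (fun k => f (X k))).
Proof.
move=> [C C0 h]; apply: (@poisson_integrable _ _ l0 _ (C * (1 + l / s)) (C / s)) => k.
have si : 0 <= s^-1 by rewrite invr_ge0 ltW.
have Xk : `|X k| <= (k%:R + l) / s.
  rewrite /standardize normrM normfV (gtr0_norm s0) ler_wpM2r//.
  by rewrite (le_trans (ler_normB _ _))// (gtr0_norm l0) ger0_norm.
apply: le_trans (h _) _.
have -> : C * (1 + l / s) + C / s * k%:R = C * (1 + (k%:R + l) / s) by ring.
by rewrite ler_wpM2l// lerD2l.
Qed.

Lemma poisson_integrable_sup f (Y : nat -> R) : sup_finite f ->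
  Q.-integrable setT (EFin \o (fun k => f (Y k))).
Proof. by move=> [C h]; apply: (@poisson_integrable_bounded _ _ l0 _ C) => k. Qed.

Lemma poisson_stein_identity G f f1 (c : R) : linear_growth G ->
  sup_finite f -> sup_finite f1 -> (forall x, f1 x = x * f x + (G x - c)) ->
  \int[Q]_k (G (X k)) - c =
  \int[Q]_k (f1 (X k) - s * (f (X k + s^-1) - f (X k))).
Proof.
move=> lG bf bf1 fE; have [C hC] := bf.
have intG := poisson_integrable_linear lG.
have intf := poisson_integrable_sup X bf.
have intf1 := poisson_integrable_sup X bf1.
have intfS := poisson_integrable_sup (fun k => X k + s^-1) bf.
have intXf := poisson_integrable_linear (sup_finite_linear_idM bf).
have intc : Q.-integrable setT (EFin \o (fun=> c)).
  exact: finite_measure_integrable_cst.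
have intd : Q.-integrable setT
    (EFin \o (fun k => s * (f (X k + s^-1) - f (X k)))).
  apply: (@eq_integrable _ _ _ _ _ _
    (fun k => s%:E * ((f (X k + s^-1))%:E - (f (X k))%:E))%E) => //.
  by apply: integrableZl => //; exact: integrableB.
(* The Poisson identity for [f \o X]: a unit jump moves [X] by [s^-1], and [l / s = s]. *)
have XfE : \int[Q]_k (X k * f (X k)) =
    s * (\int[Q]_k f (X k + s^-1) - \int[Q]_k f (X k)).
  have intkf : Q.-integrable setT (EFin \o (fun k => k%:R * f (X k))).
    apply: (@poisson_integrable _ _ l0 _ 0 C) => k.
    by rewrite add0r normrM mulrC ler_pM// ger0_norm.
  have := @Rintegral_poisson_idM _ _ l0 (f \o X) C (fun k => hC (X k)).
  under [in X in _ = X -> _]eq_Rintegral do rewrite /= standardizeS.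
  move=> /= kE.
  transitivity (s^-1 * (\int[Q]_k (k%:R * f (X k)) - l * \int[Q]_k f (X k))).
    rewrite -[l * _]RintegralZl// -RintegralB//; last first.
      apply: (@eq_integrable _ _ _ _ _ _ (fun k => l%:E * (f (X k))%:E)%E) => //.
      exact: integrableZl.
    rewrite -RintegralZl//.
      by apply: eq_Rintegral => k _; rewrite [in X in X * _]/standardize; ring.
    apply: (@eq_integrable _ _ _ _ _ _
      (fun k => (k%:R * f (X k))%:E - l%:E * (f (X k))%:E)%E) => //.
    by apply: integrableB => //; exact: integrableZl.
  by rewrite kE -mulrBr mulrA sl.
rewrite RintegralB// RintegralZl//; last first.
  apply: (@eq_integrable _ _ _ _ _ _
    (fun k => ((f (X k + s^-1))%:E - (f (X k))%:E))%E) => //.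
  exact: integrableB.
rewrite RintegralB// -XfE -RintegralB//.
rewrite -[X in _ - X = _](Rintegral_poisson_cst l) -RintegralB//.
by apply: eq_Rintegral => k _; rewrite fE; ring.
Qed.

(** The integrand of the Stein identity is [- s] times a first-order Taylor remainder of step
    [s^-1], hence of size [s * M / s^2]. *)
Lemma poisson_stein_bound1 G f f1 f2 (c M : R) : linear_growth G ->
  sup_finite f -> sup_finite f1 -> (forall y, `|f2 y| <= M) ->
  (forall y : R, is_derive y 1 f (f1 y)) ->
  (forall y : R, is_derive y 1 f1 (f2 y)) ->
  (forall x, f1 x = x * f x + (G x - c)) ->
  `|\int[Q]_k (G (X k)) - c| <= M / s.
Proof.
move=> lG bf bf1 f2M df df1 fE.
rewrite (poisson_stein_identity lG bf bf1 fE).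
apply: normr_Rintegral_poisson_le => // k.
have -> : f1 (X k) - s * (f (X k + s^-1) - f (X k)) =
    - s * (f (X k + s^-1) - f (X k) - s^-1 * f1 (X k)).
  by field; rewrite gt_eqF.
rewrite normrM normrN (gtr0_norm s0).
have h : 0 <= s^-1 by rewrite invr_ge0 ltW.
have := taylor1_bound (X k) df df1 f2M h.
rewrite -(ler_pM2l s0) => /le_trans; apply; rewrite le_eqVlt; apply/orP; left.
by apply/eqP; field; rewrite gt_eqF.
Qed.

(** Adding the [f2] term completes the second-order Taylor remainder, of size
    [s * M / s^3 = M / l]. *)
Lemma poisson_stein_bound2 G f f1 f2 f3 (c M : R) : linear_growth G ->
  sup_finite f -> sup_finite f1 -> sup_finite f2 -> (forall y, `|f3 y| <= M) ->
  (forall y : R, is_derive y 1 f (f1 y)) ->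
  (forall y : R, is_derive y 1 f1 (f2 y)) ->
  (forall y : R, is_derive y 1 f2 (f3 y)) ->
  (forall x, f1 x = x * f x + (G x - c)) ->
  `|\int[Q]_k (G (X k)) - c + (2 * s)^-1 * \int[Q]_k f2 (X k)| <= M / l.
Proof.
move=> lG bf bf1 bf2 f3M df df1 df2 fE.
have intf2 := poisson_integrable_sup X bf2.
rewrite (poisson_stein_identity lG bf bf1 fE) -RintegralZl//.
have intd : Q.-integrable setT
    (EFin \o (fun k => f1 (X k) - s * (f (X k + s^-1) - f (X k)))).
  apply: (@eq_integrable _ _ _ _ _ _
    (fun k => (f1 (X k))%:E - s%:E * ((f (X k + s^-1))%:E - (f (X k))%:E))%E) => //.
  apply: integrableB => //; first exact: poisson_integrable_sup.
  apply: integrableZl => //; apply: integrableB => //.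
    exact: (poisson_integrable_sup (fun k => X k + s^-1)).
  exact: poisson_integrable_sup.
rewrite -RintegralD//; last first.
  apply: (@eq_integrable _ _ _ _ _ _
    (fun k => ((2 * s)^-1)%:E * (f2 (X k))%:E)%E) => //.
  exact: integrableZl.
apply: normr_Rintegral_poisson_le => // k.
have -> : f1 (X k) - s * (f (X k + s^-1) - f (X k)) + (2 * s)^-1 * f2 (X k) =
    - s * (f (X k + s^-1) - f (X k) - s^-1 * f1 (X k) -
      s^-1 ^+ 2 / 2 * f2 (X k)).
  by field; rewrite gt_eqF.
rewrite normrM normrN (gtr0_norm s0).
have h : 0 <= s^-1 by rewrite invr_ge0 ltW.
have := taylor2_bound (X k) df df1 df2 f3M h.
rewrite -(ler_pM2l s0) => /le_trans; apply; rewrite le_eqVlt; apply/orP; left.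
by apply/eqP; rewrite -[in RHS]ss; field; rewrite gt_eqF.
Qed.

End poisson_stein.

(** * The third Hermite polynomial *)

Section hermite3.
Context {R : realType}.

(* The polynomial minus the claimed value is [a' - x a] for some [a] of degree
   at most 4. *)
Lemma gauss_mean_poly5 (c0 c1 c2 c3 c4 c5 : R) :
  gauss_mean (fun x => c0 + c1 * x + c2 * x ^+ 2 + c3 * x ^+ 3 + c4 * x ^+ 4
    + c5 * x ^+ 5) = c0 + c2 + 3 * c4.
Proof.
(* Powers are spelled as products, the form that [solve_tame] decomposes. *)
pose h x := c0 + c1 * x + c2 * (x * x) + c3 * (x * x * x) + c4 * (x * x * x * x)
    + c5 * (x * x * x * x * x).
have -> : (fun x => c0 + c1 * x + c2 * x ^+ 2 + c3 * x ^+ 3 + c4 * x ^+ 4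
    + c5 * x ^+ 5) = h by apply/funext => x; rewrite /h; ring.
set K := c0 + c2 + 3 * c4.
(* Found by matching the coefficients of [a' - x a] with those of [h - K] from the top degree
   down. *)
pose e3 := - 4 * c5 - c3; pose e2 := - 3 * c4 - c2; pose e1 := 2 * e3 - c1.
pose a x := e1 + e2 * x + e3 * (x * x) + - c4 * (x * x * x) +
  - c5 * (x * x * x * x).
pose a' x := e2 + 2 * e3 * x + - 3 * c4 * (x * x) + - 4 * c5 * (x * x * x).
have da (x : R) : is_derive x 1 a (a' x).
  by apply: is_derive_eq; rewrite /GRing.scale/= /a'; ring.
have ta : tame a by rewrite /a; solve_tame.
have ta' : tame a' by rewrite /a'; solve_tame.
have := integral_gauss_deriv da ta.2 ta'.
rewrite (_ : (fun x => _) = (fun x => (h x + - K) * phi x)); last first.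
  by apply/funext => x; rewrite /h /a /a' /K /e1 /e2 /e3; ring.
have th : tame h by rewrite /h; solve_tame.
rewrite -/(gauss_mean (fun x => h x + - K)) gauss_meanD//; last exact: tame_cst.
by rewrite gauss_mean_cst => /eqP; rewrite subr_eq0 => /eqP.
Qed.

Lemma horner_monic (p : {poly R}) (n : nat) (x : R) :
  p \is monic -> size p = n.+1 ->
  p.[x] = \sum_(i < n) p`_i * x ^+ i + x ^+ n.
Proof.
move=> /monicP mp sp; rewrite horner_coef sp big_ord_recr/=.
by move: mp; rewrite lead_coefE sp => ->; rewrite mul1r.
Qed.

(** The orthogonality relations among the first four polynomials become linear equations in their
    coefficients through the Gaussian moments up to degree 5, the degree of [H 2 * H 3]. *)
Lemma hermite3E (H : nat -> {poly R}) (x : R) : hermite_family H ->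
  (H 3%N).[x] = x * x * x + - (3 * x).
Proof.
move=> [mH oH].
have orth m n : m != n -> gauss_mean (fun x => (H m).[x] * (H n).[x]) = 0.
  move=> mn; have t : tame (fun x => (H m).[x] * (H n).[x]).
    by apply: tameM; exact: tame_horner.
  by have := oH m n mn; rewrite (integral_gauss_mean t) => -[].
have H0E y : (H 0%N).[y] = 1.
  have [m s] := mH 0%N; rewrite (horner_monic _ m s).
  by rewrite big_ord0 add0r expr0.
have [m1 s1] := mH 1%N; have [m2 s2] := mH 2%N; have [m3 s3] := mH 3%N.
set a := (H 1%N)`_0.
set b1 := (H 2%N)`_1; set b0 := (H 2%N)`_0.
set c2 := (H 3%N)`_2; set c1 := (H 3%N)`_1; set c0 := (H 3%N)`_0.
have H1E y : (H 1%N).[y] = a + y.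
  by rewrite (horner_monic _ m1 s1) big_ord_recr big_ord0/= expr0 expr1 -/a; ring.
have H2E y : (H 2%N).[y] = b0 + b1 * y + y ^+ 2.
  by rewrite (horner_monic _ m2 s2) !big_ord_recr big_ord0/= -/b0 -/b1; ring.
have H3E y : (H 3%N).[y] = c0 + c1 * y + c2 * y ^+ 2 + y ^+ 3.
  by rewrite (horner_monic _ m3 s3) !big_ord_recr big_ord0/= -/c0 -/c1 -/c2; ring.
have E (f : R -> R) (d0 d1 d2 d3 d4 d5 : R) : gauss_mean f = 0 ->
    (forall x, f x = d0 + d1 * x + d2 * x ^+ 2 + d3 * x ^+ 3 + d4 * x ^+ 4
      + d5 * x ^+ 5) -> d0 + d2 + 3 * d4 = 0.
  by move=> f0 fE; rewrite -(gauss_mean_poly5 _ d1 _ d3 _ d5) -(funext fE).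
have a0 : a = 0.
  have := @E _ a 1 0 0 0 0 (orth 0%N 1%N isT).
  rewrite addr0 mulr0 addr0; apply => y; rewrite H0E H1E; ring.
have b0E : b0 + 1 = 0.
  have := @E _ b0 b1 1 0 0 0 (orth 0%N 2%N isT).
  rewrite mulr0 addr0; apply => y; rewrite H0E H2E; ring.
have b10 : b1 = 0.
  have := @E _ 0 b0 b1 1 0 0 (orth 1%N 2%N isT).
  rewrite mulr0 addr0 add0r; apply => y; rewrite H1E H2E a0; ring.
have c02 : c0 + c2 = 0.
  have := @E _ c0 c1 c2 1 0 0 (orth 0%N 3%N isT).
  rewrite mulr0 addr0; apply => y; rewrite H0E H3E; ring.
have c1E : c1 + 3 = 0.
  have := @E _ 0 c0 c1 c2 1 0 (orth 1%N 3%N isT).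
  rewrite mulr1 add0r; apply => y; rewrite H1E H3E a0; ring.
have b0N : b0 = - 1 by lra.
have c2E : - c0 + (c0 - c2) + 3 * c2 = 0.
  apply: (@E _ (- c0) (- c1) (c0 - c2) (c1 - 1) c2 1 (orth 2%N 3%N isT)) => y.
  rewrite H2E H3E b10 b0N; ring.
have c20 : c2 = 0 by lra.
have c00 : c0 = 0 by lra.
have c1N : c1 = - 3 by lra.
by rewrite H3E c20 c00 c1N; ring.
Qed.

(** This identifies the correction [- gauss_mean f2 / (2 s)] with the Hermite integral divided by
    [6 s]. *)
Lemma gauss_mean_hermite3 (G f f1 f2 : R -> R) (c : R) :
  (forall x : R, is_derive x 1 f (f1 x)) ->
  (forall x : R, is_derive x 1 f1 (f2 x)) ->
  tame f -> tame f1 -> tame f2 ->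
  (forall x, f1 x = x * f x + (G x - c)) ->
  gauss_mean (fun x => G x * (x * x * x + - (3 * x))) = - 3 * gauss_mean f2.
Proof.
move=> df df1 tf tf1 tf2 fE.
have GE : G = (fun x => f1 x + - (x * f x) + c).
  by apply/funext => x; rewrite fE; ring.
(* Let [L a = a' - x a], so [G = L f + c]. Then [L (f H3) = H3 L f + 3 f H2],
   [L (3 f1 + 3 x f) = 3 f2 - 3 f H2] and [L (- c H2) = c H3]; the sum is [G H3 + 3 f2]. *)
pose a x := f x * (x * x * x + - (3 * x)) + 3 * f1 x + 3 * (x * f x) +
  - c * (x * x + - 1).
pose a' x := f1 x * (x * x * x + - (3 * x)) + f x * (3 * (x * x) + - 3) +
  3 * f2 x + 3 * (f x + x * f1 x) + - c * (2 * x).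
have da (x : R) : is_derive x 1 a (a' x).
  have dfx := df x; have df1x := df1 x.
  by apply: is_derive_eq; rewrite /GRing.scale/= /a'; ring.
have ta : tame a by rewrite /a; solve_tame.
have ta' : tame a' by rewrite /a'; solve_tame.
have := integral_gauss_deriv da ta.2 ta'.
rewrite (_ : (fun x => (a' x - x * a x) * phi x) =
    (fun x => (G x * (x * x * x + - (3 * x)) + 3 * f2 x) * phi x)); last first.
  by apply/funext => x; rewrite GE /a /a' /=; ring.
rewrite -/(gauss_mean (fun x => G x * (x * x * x + - (3 * x)) + 3 * f2 x)).
have tG : tame G by rewrite GE; solve_tame.
by rewrite gauss_meanD ?gauss_meanZ//; [move=> e; lra|solve_tame|solve_tame].
Qed.

End hermite3.

(** * The asymptotic expansion *)

Lemma bounded_fun_sup_finite (R : realType) (f : R -> R) :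
  bounded_fun f -> sup_finite f.
Proof. by move=> /pinfty_ex_gt0[M _ fM]; exists M => x; exact: fM. Qed.

Lemma expectation_poisson_rv (R : realType) (l : R) (d : measure_display)
    (T : measurableType d) (P : probability T R) (Z : {RV P >-> nat})
    (h : nat -> R) :
  poisson_rv l Z ->
  (poisson_prob l 0%N : {measure set nat -> \bar R}).-integrable setT (EFin \o h) ->
  ('E_P[fun w => h (Z w)] = (\int[poisson_prob l 0%N]_k h k)%:E)%E.
Proof.
move=> hZ inth; have mh : measurable_fun [set: nat] (EFin \o h) by [].
(* Integrability passes to [P] by the image-measure formula for the nonnegative function [|h|]. *)
have intZ : P.-integrable setT ((EFin \o h) \o Z).
  apply/integrableP; split; first exact: measurableT_comp.
  have /integrableP[_] := inth; apply: le_lt_trans.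
  have := @ge0_integral_distribution _ _ _ _ _ P Z (fun k => `|(EFin \o h) k|%E).
  by rewrite hZ => ->.
rewrite unlock -(integral_distribution mh intZ) hZ.
by rewrite /Rintegral fineK//; exact: integrable_fin_num.
Qed.

Theorem mainTheorem2 (R : realType) (H : nat -> {poly R})
    (hH : hermite_family H) (F : R -> R) (hF : thrice_derivable_bounded F) :
  exists2 C : R, 0 < C &
    \forall l \near +oo%R,
      forall (d : measure_display) (T : measurableType d)
        (P : probability T R) (Z : {RV P >-> nat}),
      poisson_rv l Z ->
      (`| ('E_P[fun w => F (standardize l (Z w))]
             - \int[normal_prob (0 : R) 1]_x (F x)%:E)
          - ((6 * Num.sqrt l)^-1)%:E
             * \int[normal_prob (0 : R) 1]_x (F x * (H 3%N).[x])%:E |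
        <= (C * l^-1)%:E)%E.
Proof.
case: hF => dF bF.
pose F1 := (F^`(1))%classic; pose F2 := (F^`(2))%classic.
pose F3 := (F^`(3))%classic.
have dF0 (x : R) : is_derive x 1 F (F1 x).
  by rewrite /F1 derive1n1 derive1E; apply/derivableP; exact: (dF 0%N).
have dF1 (x : R) : is_derive x 1 F1 (F2 x).
  by rewrite /F2 derive1nS derive1E; apply/derivableP; exact: (dF 1%N).
have dF2 (x : R) : is_derive x 1 F2 (F3 x).
  by rewrite /F3 derive1nS derive1E; apply/derivableP; exact: (dF 2%N).
have bF1 : sup_finite F1 by apply: bounded_fun_sup_finite; exact: bF.
have bF2 : sup_finite F2 by apply: bounded_fun_sup_finite; exact: bF.
have bF3 : sup_finite F3 by apply: bounded_fun_sup_finite; exact: bF.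
have [f [f1 [f2 [df df1 df2 [bf bf1 bf2] fE]]]] :=
  stein_solution_derivatives dF0 dF1 bF1 (sup_finite_linear bF2).
(* The next two derivatives of the Stein solution, read off from its equation. *)
pose f3 x := x * f2 x + (2 * f1 x + F2 x).
pose f4 x := x * f3 x + (3 * f2 x + F3 x).
have df3 (x : R) : is_derive x 1 f3 (f4 x).
  have dfx := df1 x; have df2x := df2 x; have dFx := dF2 x.
  by apply: is_derive_eq; rewrite /GRing.scale/= /f4 /f3; ring.
have lf3 : linear_growth f3.
  apply: linear_growthD; first exact: sup_finite_linear_idM.
  by apply: sup_finite_linear; apply: sup_finiteD => //; exact: sup_finiteZ.
have bf3 : sup_finite f3.
  exact: stein_solution_third_derivative df3 lf3 bf2 bF3.
have lf4 : linear_growth f4.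
  apply: linear_growthD; first exact: sup_finite_linear_idM.
  by apply: sup_finite_linear; apply: sup_finiteD => //; exact: sup_finiteZ.
(* Second Stein equation, with source [f2]; this is where bounded [f3] and linear growth of [f4] are
   used. *)
have [g [g1 [g2 [dg dg1 _ [bg bg1 bg2] gE]]]] :=
  stein_solution_derivatives df2 df3 bf3 lf4.
have [M3 f3M] := bf3; have [M2 g2M] := bg2.
have M30 : 0 <= M3 by apply: le_trans (f3M 0).
have M20 : 0 <= M2 by apply: le_trans (g2M 0).
have lF : linear_growth F by exact: sup_finite_derive_linear dF0 bF1.
have tame_lin (u u1 : R -> R) : (forall x : R, is_derive x 1 u (u1 x)) ->
    linear_growth u -> tame u.
  move=> du lu; split; last exact: linear_poly_growth.
  by move=> x; exact: is_derive_continuous (du x).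
have tF := tame_lin _ _ dF0 lF.
have tf := tame_lin _ _ df (sup_finite_linear bf).
have tf1 := tame_lin _ _ df1 (sup_finite_linear bf1).
have tf2 := tame_lin _ _ df2 (sup_finite_linear bf2).
have FH : (\int[normal_prob (0 : R) 1]_x (F x * (H 3%N).[x])%:E =
    (- 3 * gauss_mean f2)%:E)%E.
  rewrite (_ : (fun x => (F x * (H 3%N).[x])%:E) =
      (fun x => (F x * (x * x * x + - (3 * x)))%:E)); last first.
    by apply/funext => x; rewrite (hermite3E _ hH).
  rewrite (@integral_gauss_mean _ (fun x => F x * (x * x * x + - (3 * x)))).
    by rewrite (gauss_mean_hermite3 df df1 tf tf1 tf2 fE).
  by solve_tame.
(* [M3] comes from the Taylor remainder for [f], [M2 / 2] from replacing the Poisson mean of [f2] by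
   its Gaussian mean, and 1 ensures positivity. All are fixed before [l]. *)
exists (M3 + M2 / 2 + 1); first lra.
near=> l => d T P Z hZ.
have l0 : 0 < l by near: l; apply: nbhs_pinfty_gt; exact: num_real.
have s0 : 0 < Num.sqrt l by rewrite sqrtr_gt0.
have ss : Num.sqrt l * Num.sqrt l = l by rewrite -expr2 sqr_sqrtr// ltW.
rewrite (@expectation_poisson_rv _ l _ _ _ _ (F \o standardize l) hZ); last first.
  exact: poisson_integrable_linear.
rewrite FH (integral_gauss_mean tF) -EFinB abse_EFin lee_fin.
have b2 := poisson_stein_bound2 l0 lF bf bf1 bf2 f3M df df1 df2 fE.
have b1 := poisson_stein_bound1 l0 (sup_finite_linear bf2) bg bg1 g2M dg dg1 gE.
move: b1 b2; rewrite /=.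
set a := \int[_]_k F _; set b := \int[_]_k f2 _; set c := gauss_mean F.
set e := gauss_mean f2 => b1 b2.
(* The first group is bounded by [b2]; in the second, [b1] makes [b - e] of order [1 / sqrt l], and
   the prefactor supplies the other [1 / sqrt l]. *)
have -> : a - c - (6 * Num.sqrt l)^-1 * (- 3 * e) =
    (a - c + (2 * Num.sqrt l)^-1 * b) - (2 * Num.sqrt l)^-1 * (b - e).
  by field; rewrite gt_eqF.
rewrite (le_trans (ler_normB _ _))//.
have b1' : `|(2 * Num.sqrt l)^-1 * (b - e)| <= M2 / 2 / l.
  have h : 0 <= (2 * Num.sqrt l)^-1 by rewrite invr_ge0 mulr_ge0// ltW.
  rewrite normrM (ger0_norm h).
  apply: le_trans (ler_wpM2l h b1) _; rewrite -[in leRHS]ss.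
  by rewrite le_eqVlt; apply/orP; left; apply/eqP; field; rewrite gt_eqF.
rewrite (le_trans (lerD b2 b1'))// -mulrDl ler_wpM2r ?invr_ge0 ?(ltW l0)//.
by rewrite lerDl.
Unshelve. all: by end_near. Qed.
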